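(* There exists an absolute constant $C>0$ such that the following holds. Let $n\ge 2$ be even, let $0\le q<p\le 1$, and let $A$ be the adjacency matrix of a random graph following the stochastic block model $G(n,p,q)$. Then $$\mathbb{E}\|A-\mathbb{E}A\|\le C\left(\sqrt{d\log n}+\log n\right),$$ where $d=(p+q)n/2$ is the expected degree.
   Context: $\|\cdot\|$ is the operator norm of a matrix with respect to the Euclidean norm. Stochastic block model $G(n,p,q)$: the vertex set $\{1,\dots,n\}$ is partitioned into two subsets (''communities'') with $n/2$ vertices each, and every pair of vertices is connected by an edge independently, with probability $p$ if they belong to the same community and with probability $q<p$ if not. The adjacency matrix $A$ is the $n\times n$ symmetric random matrix with $A_{ij}=1$ if $i$ and $j$ are connected and $A_{ij}=0$ otherwise. Convention: a pair $i=j$ is treated as a pair within the same community, so that the entries $A_{ij}$, $i\le j$, are independent Bernoulli variables with $\mathbb{E}A_{ij}=p$ if $i,j$ are in the same community (including $i=j$) and $\mathbb{E}A_{ij}=q$ otherwise. *)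

(* Defs.v *)
(* MathComp and MathComp-Analysis. *)
From HB Require Import structures.
From mathcomp Require Import all_boot all_order all_algebra.
From mathcomp Require Import all_classical all_reals all_analysis.

Set Implicit Arguments.
Unset Strict Implicit.
Unset Printing Implicit Defensive.

Import Order.TTheory GRing.Theory Num.Theory.
Import numFieldNormedType.Exports.

Local Open Scope classical_set_scope.
Local Open Scope ring_scope.

Definition l2norm (R : realType) (n : nat) (x : 'cV[R]_n) : R :=
  Num.sqrt (\sum_(i < n) x i 0 ^+ 2).

(* The library norm on matrices is the entrywise maximum; this one is induced
   by the Euclidean norms of the domain and the codomain. *)
Definition opnorm (R : realType) (m n : nat) (M : 'M[R]_(m, n)) : R :=
  sup [set l2norm (M *m x) | x in [set x : 'cV[R]_n | l2norm x <= 1]].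

(* The subfamily of X indexed by D is mutually independent. *)
Definition mutually_independent (disp disp' : measure_display)
    (T : measurableType disp) (T' : measurableType disp') (R : realType)
    (P : probability T R) (I : finType) (D : {set I})
    (X : I -> {RV P >-> T'}) : Prop :=
  forall (J : {set I}) (B : I -> set T'),
    J \subset D -> (forall i, measurable (B i)) ->
    P (\bigcap_(i in [set` J]) X i @^-1` B i) =
    (\prod_(i in J) P (X i @^-1` B i))%E.

(* [E i j] is the indicator that i and j are joined by an edge, and [comm]
   labels the vertices by their community.  Each unordered pair is represented
   once, by i <= j; the pair i = j counts as a pair within a community, so
   loops are present with probability p. *)
Record stochastic_block_model (disp : measure_display)
    (T : measurableType disp) (R : realType) (P : probability T R) (n : nat)
    (p q : R) (comm : 'I_n -> bool) (E : 'I_n -> 'I_n -> {RV P >-> bool}) :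
    Prop := StochasticBlockModel {
  sbm_balanced : forall b, #|[set i | comm i == b]%SET| = n./2 ;
  sbm_sym : forall i j w, E i j w = E j i w ;
  sbm_bernoulli : forall i j,
    distribution P (E i j) =1
      bernoulli_prob (if comm i == comm j then p else q) ;
  sbm_indep :
    mutually_independent [set e : 'I_n * 'I_n | (e.1 <= e.2)%N]%SET
      (fun e => E e.1 e.2) }.

Definition adjacency_matrix (disp : measure_display)
    (T : measurableType disp) (R : realType) (P : probability T R) (n : nat)
    (E : 'I_n -> 'I_n -> {RV P >-> bool}) (w : T) : 'M[R]_n :=
  \matrix_(i, j) (E i j w)%:R.

Definition expected_matrix (disp : measure_display)
    (T : measurableType disp) (R : realType) (P : probability T R)
    (m n : nat) (A : T -> 'M[R]_(m, n)) : 'M[R]_(m, n) :=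
  \matrix_(i, j) fine ('E_P[fun w => A w i j])%E.

(* Main.v *)
(* Moment method. Let X = A - E A and N = 2K, with K a power of two of order
   log n. For symmetric X, iterating |Xx|^2 = <x, X^2 x> <= |x| |X^2 x| gives
   ||X||^N <= tr X^N. In E tr X^N, independence kills every closed walk that
   uses some edge exactly once, and each distinct edge e of a surviving walk
   contributes at most p_e. Building the walk step by step, a step either
   repeats one of at most N earlier edges or takes a new edge, the latter having
   total weight at most d; since at most K edges are distinct,
   E tr X^N <= n (4N(N + d))^K. *)
Require Import Defs.
From HB Require Import structures.
From mathcomp Require Import all_boot all_order all_algebra.
From mathcomp Require Import all_classical all_reals all_analysis.
From mathcomp Require Import measurable_realfun.
From mathcomp Require Import ring lra zify.

Set Implicit Arguments.
Unset Strict Implicit.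
Unset Printing Implicit Defensive.

Import Order.TTheory GRing.Theory Num.Theory.
Import numFieldNormedType.Exports.

Local Open Scope classical_set_scope.
Local Open Scope ring_scope.

(** * Means under finite products of Bernoulli laws *)

Definition bern (R : realType) (x : R) (b : bool) : R := if b then x else 1 - x.

(** The expectation under a product of Bernoulli laws, kept as a finite sum so that linearity and
    monotonicity are plain algebra. *)
Definition bern_mean (R : realType) (I : finType) (pr : I -> R)
    (f : {ffun I -> bool} -> R) : R :=
  \sum_(e : {ffun I -> bool}) (\prod_i bern (pr i) (e i)) * f e.

(** Independence in algebraic form: expanding the product of sums yields one term per
    configuration. *)
Lemma bern_mean_prod (R : realType) (I : finType) (pr : I -> R)
    (g : I -> bool -> R) :
  bern_mean pr (fun e => \prod_i g i (e i)) =
  \prod_i \sum_b bern (pr i) b * g i b.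
Proof.
rewrite bigA_distr_bigA /bern_mean; apply: eq_bigr => e _.
by rewrite -big_split.
Qed.

Lemma bern_mean1 (R : realType) (I : finType) (pr : I -> R) :
  bern_mean pr (fun=> 1) = 1.
Proof.
rewrite (_ : bern_mean pr _ =
    bern_mean pr (fun e => \prod_i (fun _ _ => 1) i (e i))); last first.
  by apply: eq_bigr => e _; rewrite big1_eq.
rewrite (bern_mean_prod pr (fun _ _ => 1)) big1 // => i _.
by rewrite big_bool /= !mulr1 /bern subrKC.
Qed.

Lemma bern_mean_le (R : realType) (I : finType) (pr : I -> R)
    (f g : {ffun I -> bool} -> R) :
  (forall i, 0 <= pr i <= 1) -> (forall e, f e <= g e) ->
  bern_mean pr f <= bern_mean pr g.
Proof.
move=> pr01 fg; apply: ler_sum => e _; apply: ler_wpM2l => //.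
apply: prodr_ge0 => i _; rewrite /bern.
by have /andP[? ?] := pr01 i; case: ifP => // _; rewrite subr_ge0.
Qed.

Lemma bern_meanZ (R : realType) (I : finType) (pr : I -> R) (b : R)
    (f : {ffun I -> bool} -> R) :
  bern_mean pr (fun e => b * f e) = b * bern_mean pr f.
Proof. by rewrite /bern_mean mulr_sumr; apply: eq_bigr => e _; ring. Qed.

Lemma bern_meanDl (R : realType) (I : finType) (pr : I -> R) (a : R)
    (f : {ffun I -> bool} -> R) :
  bern_mean pr (fun e => a + f e) = a + bern_mean pr f.
Proof.
rewrite -{2}[a]mulr1 -(bern_mean1 pr) -bern_meanZ -big_split /=.
by apply: eq_bigr => e _; ring.
Qed.

Lemma bern_mean_sum (R : realType) (I J : finType) (pr : I -> R)
    (f : J -> {ffun I -> bool} -> R) :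
  bern_mean pr (fun e => \sum_j f j e) = \sum_j bern_mean pr (f j).
Proof.
rewrite /bern_mean exchange_big /=; apply: eq_bigr => e _.
by rewrite mulr_sumr.
Qed.

(** * Central moments and products of centered indicators *)

Lemma prod_seq_count (R : realType) (I : finType) (F : I -> R) (s : seq I) :
  \prod_(x <- s) F x = \prod_i F i ^+ count_mem i s.
Proof.
elim: s => [|x s IH]; first by rewrite big_nil big1.
rewrite big_cons IH.
rewrite [RHS](eq_bigr (fun i => F i ^+ (x == i) * F i ^+ count_mem i s));
  last first.
  by move=> i _; rewrite -exprD.
rewrite big_split /=; congr (_ * _).
rewrite (bigD1 x) //= eqxx expr1 big1 ?mulr1 // => i /negPf.
by rewrite eq_sym => ->.
Qed.

Lemma size_sum_count (I : finType) (s : seq I) :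
  size s = (\sum_i count_mem i s)%N.
Proof.
elim: s => [|x s IH] /=; first by rewrite big1.
rewrite big_split /= -IH (bigD1 x) //= eqxx big1 // => i /negPf.
by rewrite eq_sym => ->.
Qed.

Definition cmoment (R : realType) (x : R) (m : nat) : R :=
  \sum_(b : bool) bern x b * (b%:R - x) ^+ m.

Lemma cmoment0 (R : realType) (x : R) : cmoment x 0 = 1.
Proof. by rewrite /cmoment big_bool /bern /=; ring. Qed.

Lemma cmoment1 (R : realType) (x : R) : cmoment x 1 = 0.
Proof. by rewrite /cmoment big_bool /bern /=; ring. Qed.

Lemma cmoment_le (R : realType) (x : R) (m : nat) :
  0 <= x <= 1 -> `|cmoment x m.+2| <= x.
Proof.
move=> /andP[x0 x1]; rewrite /cmoment big_bool /bern /= sub0r.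
have y0 : 0 <= 1 - x by rewrite subr_ge0.
apply: (le_trans (ler_normD _ _)).
rewrite (normrM x) (normrM (1 - x) (_ ^+ _)) (normrX _ (1 - x)) (normrX _ (- x)).
rewrite normrN !ger0_norm //.
(* These two bounds give the total [x * (1 - x) + (1 - x) * x ^+ 2 = x - x ^+ 3]. *)
have h1 : (1 - x) ^+ m.+2 <= 1 - x.
  by rewrite exprS ler_piMr // exprn_ile1 // gerBl.
have h2 : x ^+ m.+2 <= x ^+ 2.
  by rewrite -addn2 exprD ler_piMl ?sqr_ge0 // exprn_ile1.
apply: (le_trans (lerD (ler_wpM2l x0 h1) (ler_wpM2l y0 h2))).
have x3 : 0 <= x ^+ 3 by apply: exprn_ge0.
by nra.
Qed.

(** The mean factors into central moments, one per index. An index occurring once makes it vanish;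
    otherwise each index present contributes at most its probability. The parameter [theta] is left
    free, to be tuned in the walk count. *)
Lemma bern_mean_centered_le (R : realType) (I : finType) (pr : I -> R)
    (theta : R) (K : nat) (s : seq I) :
  (forall i, 0 <= pr i <= 1) -> 0 < theta -> theta <= 1 -> size s = K.*2 ->
  bern_mean pr (fun e => \prod_(x <- s) ((e x)%:R - pr x)) <=
  theta ^- K * \prod_(x in [set x in s]%SET) (theta * pr x).
Proof.
move=> pr01 th0 th1 sz.
have -> : bern_mean pr (fun e => \prod_(x <- s) ((e x)%:R - pr x)) =
    \prod_i cmoment (pr i) (count_mem i s).
  rewrite -(bern_mean_prod pr (fun i b => (b%:R - pr i) ^+ count_mem i s)).
  apply: eq_bigr => e _.
  by rewrite (prod_seq_count (fun i => (e i)%:R - pr i)).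
have pr0 i : 0 <= pr i by have /andP[] := pr01 i.
have [/existsP[i /eqP ci]|/existsPn nc] :=
    boolP [exists i, count_mem i s == 1%N].
  rewrite (bigD1 i) //= ci cmoment1 mul0r mulr_ge0 //.
    by rewrite invr_ge0 exprn_ge0 // ltW.
  by apply: prodr_ge0 => x _; rewrite mulr_ge0 // ltW.
have count2 i : i \in s -> (2 <= count_mem i s)%N.
  by rewrite -has_pred1 has_count; move: (nc i); case: count => [|[|]].
(* Double counting: every index present takes up at least two of the [K.*2] positions. *)
have cardK : (#|[set x in s]%SET| <= K)%N.
  rewrite -leq_double -sz (size_sum_count s) -muln2 -sum_nat_const.
  rewrite [leqRHS](bigID (fun x => x \in [set x in s]%SET)) /=.
  apply: (leq_trans _ (leq_addr _ _)); apply: leq_sum => x.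
  by rewrite inE => /count2.
apply: (le_trans (ler_norm _)); rewrite normr_prod.
apply: (@le_trans _ _ (\prod_(x in [set x in s]%SET) pr x)).
  rewrite [leRHS]big_mkcond /=; apply: ler_prod => i _.
  rewrite normr_ge0 inE /=; case: ifPn => is_; last first.
    by rewrite (count_memPn is_) cmoment0 normr1.
  by case: (count_mem i s) (count2 i is_) => [|[|m]] // _; apply: cmoment_le.
(* Since [theta <= 1] and at most [K] indices are present, their powers of [theta] are outweighed by
   [theta ^- K]. *)
rewrite big_split /= prodr_const mulrA ler_peMl ?prodr_ge0 //.
rewrite ler_pdivlMl ?exprn_gt0 // mulr1.
by apply: ler_wiXn2l => //; rewrite ltW.
Qed.

(** * Sums over walks *)

(** All walks of [m] steps from [v] are summed over, [f] receiving the end vertex and the edges in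
    order. Each step is absorbed into [f], so inductions run with [f] general and the weight of a
    first edge can be pulled out. *)
Fixpoint walk_sum (R : realType) (I : Type) (n : nat)
    (ed : 'I_n -> 'I_n -> I) (m : nat) (v : 'I_n)
    (f : 'I_n -> seq I -> R) : R :=
  if m is m'.+1
  then \sum_u walk_sum ed m' u (fun z es => f z (ed v u :: es))
  else f v [::].

Lemma eq_walk_sum (R : realType) (I : Type) (n : nat)
    (ed : 'I_n -> 'I_n -> I) (m : nat) (v : 'I_n) (f g : 'I_n -> seq I -> R) :
  (forall z es, f z es = g z es) -> walk_sum ed m v f = walk_sum ed m v g.
Proof.
elim: m v f g => [|m IH] v f g fg /=; first exact: fg.
by apply: eq_bigr => u _; apply: IH => z es; apply: fg.
Qed.

Lemma walk_sum_le (R : realType) (I : Type) (n : nat)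
    (ed : 'I_n -> 'I_n -> I) (m : nat) (v : 'I_n) (f g : 'I_n -> seq I -> R) :
  (forall z es, size es = m -> f z es <= g z es) ->
  walk_sum ed m v f <= walk_sum ed m v g.
Proof.
elim: m v f g => [|m IH] v f g fg /=; first exact: fg.
by apply: ler_sum => u _; apply: IH => z es sz; apply: fg => /=; rewrite sz.
Qed.

Lemma walk_sumZ (R : realType) (I : Type) (n : nat)
    (ed : 'I_n -> 'I_n -> I) (m : nat) (v : 'I_n) (c : R)
    (f : 'I_n -> seq I -> R) :
  walk_sum ed m v (fun z es => c * f z es) = c * walk_sum ed m v f.
Proof.
elim: m v f => [|m IH] v f //=; rewrite mulr_sumr.
by apply: eq_bigr => u _; rewrite IH.
Qed.

Lemma bern_mean_walk_sum (R : realType) (I J : finType) (pr : J -> R) (n : nat)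
    (ed : 'I_n -> 'I_n -> I) (m : nat) (v : 'I_n)
    (f : {ffun J -> bool} -> 'I_n -> seq I -> R) :
  bern_mean pr (fun e => walk_sum ed m v (f e)) =
  walk_sum ed m v (fun z es => bern_mean pr (fun e => f e z es)).
Proof.
elim: m v f => [|m IH] v f //=.
by rewrite bern_mean_sum; apply: eq_bigr => u _; rewrite IH.
Qed.

(** The usual expansion of a matrix power; the end vertex is free in [walk_sum], so an indicator
    pins it to [z]. *)
Lemma mulmx_power_walk_sum (R : realType) (I : Type) (n : nat)
    (ed : 'I_n -> 'I_n -> I) (F : I -> R) (M : 'M[R]_n) (m : nat)
    (v z : 'I_n) :
  (forall i j, M i j = F (ed i j)) ->
  (M ^+ m) v z =
  walk_sum ed m v (fun z' es => (z' == z)%:R * \prod_(x <- es) F x).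
Proof.
move=> MF; elim: m v => [|m IH] v /=.
  by rewrite expr0 mxE big_nil mulr1.
rewrite exprS [M * _]/(M *m _) mxE; apply: eq_bigr => u _.
rewrite IH MF -walk_sumZ; apply: eq_walk_sum => z' es.
by rewrite big_cons mulrCA.
Qed.

(* The next vertex is either forced by the choice of a repeated edge of [S],
   or reached through a new edge, which contributes its weight. *)
Lemma walk_sum_distinct_le (R : realType) (I : finType) (n : nat)
    (ed : 'I_n -> 'I_n -> I) (w : I -> R) (delta : R) (N m : nat)
    (S : {set I}) (v : 'I_n) :
  (forall i, injective (ed i)) -> (forall x, 0 <= w x) -> 0 <= delta ->
  (forall i, \sum_j w (ed i j) <= delta) -> (#|S| + m <= N)%N ->
  walk_sum ed m v (fun _ es => \prod_(x in [set x in es]%SET :\: S) w x) <=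
  (delta + N%:R) ^+ m.
Proof.
move=> ed_inj w0 d0 wd; elim: m S v => [|m IH] S v SN /=.
  rewrite expr0 big_pred0 // => x; rewrite !inE andbF //.
have B0 : 0 <= (delta + N%:R) ^+ m by rewrite exprn_ge0 // addr_ge0.
(* An edge of [S] costs [1], a fresh one costs its weight; adding both costs lets the two sums be
   bounded separately. *)
apply: (@le_trans _ _ (\sum_u ((ed v u \in S)%:R + w (ed v u)) *
    (delta + N%:R) ^+ m)).
  apply: ler_sum => u _; have [eS|eS] := boolP (ed v u \in S).
    rewrite (@eq_walk_sum R I n ed m u _
      (fun _ es => \prod_(x in [set x in es]%SET :\: S) w x)); last first.
      move=> z es; apply: eq_bigl => x; rewrite !inE.
      by have [->|] := eqVneq x (ed v u); rewrite ?eS.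
    rewrite mulrDl mul1r ler_wpDr ?mulr_ge0 //; apply: IH.
    by apply: leq_trans SN; rewrite leq_add2l.
  (* A fresh edge joins [S], so its repetitions are not charged again; the total of [#|S|] and the
     remaining steps stays the same. *)
  rewrite (@eq_walk_sum R I n ed m u _ (fun _ es => w (ed v u) *
      \prod_(x in [set x in es]%SET :\: (ed v u |: S)%SET) w x)); last first.
    move=> z es; rewrite (big_setD1 (ed v u)) /=; last by rewrite !inE eqxx eS.
    congr (_ * _); apply: eq_bigl => x; rewrite !inE.
    by have [] := eqVneq x (ed v u).
  rewrite walk_sumZ add0r ler_wpM2l //; apply: IH.
  by rewrite cardsU1 eS add1n addSnnS.
rewrite -mulr_suml exprS ler_wpM2r // big_split /= addrC lerD //.
rewrite -natr_sum ler_nat.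
(* By injectivity of [ed v], each edge of [S] leads to at most one next vertex. *)
apply: (@leq_trans #|S|); last by apply: leq_trans SN; apply: leq_addr.
rewrite -big_mkcond sum1_card -(card_imset _ (ed_inj v)); apply: subset_leq_card.
by apply/fintype.subsetP => x /imsetP[u uS ->].
Qed.

(** * The mean trace of a power of the centered matrix *)

Definition centered_mx (R : realType) (I : finType) (n : nat)
    (ed : 'I_n -> 'I_n -> I) (pr : I -> R) (e : {ffun I -> bool}) : 'M[R]_n :=
  \matrix_(i, j) ((e (ed i j))%:R - pr (ed i j)).

(* [theta] is chosen so that a new edge and a repeated edge cost the same; since
   every edge is used at least twice there are at most [K] new edges, whence the
   factor [theta ^- K]. *)
Lemma mean_trace_le (R : realType) (I : finType) (n : nat)
    (ed : 'I_n -> 'I_n -> I) (pr : I -> R) (d : R) (K : nat) :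
  (forall i, injective (ed i)) -> (forall x, 0 <= pr x <= 1) -> 0 <= d ->
  (forall i, \sum_j pr (ed i j) <= d) -> (0 < K)%N ->
  bern_mean pr (fun e => \tr (centered_mx ed pr e ^+ K.*2)) <=
  n%:R * (4 * K.*2%:R * (K.*2%:R + d)) ^+ K.
Proof.
move=> ed_inj pr01 d0 prd K0; set N : R := K.*2%:R.
have N0 : 0 < N by rewrite ltr0n double_gt0.
have Nd : 0 < N + d by rewrite ltr_wpDr.
pose theta := N / (N + d).
have th0 : 0 < theta by rewrite divr_gt0.
have th1 : theta <= 1 by rewrite ler_pdivrMr // mul1r lerDl.
have thd : theta * d <= N.
  by rewrite /theta mulrAC ler_pdivrMr // ler_pM2l // lerDr ltW.
rewrite bern_mean_sum mulr_natl -[X in _ *+ X]card_ord -sumr_const.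
apply: ler_sum => v _.
have -> : bern_mean pr (fun e => (centered_mx ed pr e ^+ K.*2) v v) =
    walk_sum ed K.*2 v (fun z es => bern_mean pr (fun e => (z == v)%:R *
      \prod_(x <- es) ((e x)%:R - pr x))).
  rewrite -bern_mean_walk_sum; apply: eq_bigr => e _; congr (_ * _).
  by apply: mulmx_power_walk_sum => i j; rewrite mxE.
pose w x := theta * pr x.
have w0 x : 0 <= w x by rewrite mulr_ge0 ?(ltW th0) //; have /andP[] := pr01 x.
(* The requirement that the walk be closed is dropped here: the bounding terms are nonnegative, so
   open walks may be included. *)
apply: (@le_trans _ _ (walk_sum ed K.*2 v (fun _ es =>
    theta ^- K * \prod_(x in [set x in es]%SET :\: finset.set0) w x))).
  apply: walk_sum_le => z es sz; rewrite finset.setD0.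
  rewrite bern_meanZ; have le := bern_mean_centered_le pr01 th0 th1 sz.
  case: eqP => _; first by rewrite mul1r.
  rewrite mul0r mulr_ge0 //; last exact: prodr_ge0.
  by rewrite invr_ge0 exprn_ge0 // ltW.
rewrite walk_sumZ ler_pdivrMl ?exprn_gt0 //.
apply: (@le_trans _ _ ((theta * d + N) ^+ K.*2)).
  apply: walk_sum_distinct_le => //.
  - by rewrite mulr_ge0 // ltW.
  - by move=> i; rewrite -mulr_sumr ler_pM2l //; apply: prd.
  - by rewrite cards0.
rewrite -exprMn -mul2n exprM; apply: lerXn2r.
- by rewrite nnegrE sqr_ge0.
- by rewrite nnegrE mulr_ge0 ?(ltW th0) // mulr_ge0 ?(ltW Nd) // mulr_ge0 // ltW.
(* This is where the constant [4] comes from: [theta * d + N] is at most [2 * N]. *)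
have -> : theta * (4 * N * (N + d)) = (2 * N) ^+ 2.
  by rewrite /theta; field; rewrite gt_eqF.
apply: lerXn2r.
- by rewrite nnegrE addr_ge0 ?(ltW N0) // mulr_ge0 // ltW.
- by rewrite nnegrE mulr_ge0 // ltW.
by rewrite mulr_natl mulr2n lerD2r.
Qed.

(** * Euclidean norms, and the operator norm against the trace *)

(** Cauchy-Schwarz through Lagrange's identity: the double sum of squares is twice the defect. *)
Lemma sum_mul_sqr_le (R : realType) (I : finType) (x y : I -> R) :
  (\sum_i x i * y i) ^+ 2 <= (\sum_i x i ^+ 2) * (\sum_i y i ^+ 2).
Proof.
have : 0 <= \sum_i \sum_j (x i * y j - x j * y i) ^+ 2.
  by apply: sumr_ge0 => i _; apply: sumr_ge0 => j _; apply: sqr_ge0.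
have -> : \sum_i \sum_j (x i * y j - x j * y i) ^+ 2 =
    2 * ((\sum_i x i ^+ 2) * (\sum_i y i ^+ 2) - (\sum_i x i * y i) ^+ 2).
  have -> : 2 * ((\sum_i x i ^+ 2) * (\sum_i y i ^+ 2) - (\sum_i x i * y i) ^+ 2)
    = (\sum_i x i ^+ 2) * (\sum_j y j ^+ 2)
      - 2 * ((\sum_i x i * y i) * (\sum_j x j * y j))
      + (\sum_i y i ^+ 2) * (\sum_j x j ^+ 2) by ring.
  rewrite !mulr_suml mulr_sumr -sumrB -big_split /=; apply: eq_bigr => i _.
  rewrite !mulr_sumr -sumrB -big_split /=; apply: eq_bigr => j _; ring.
by rewrite pmulr_rge0 // subr_ge0.
Qed.

Definition sqnorm (R : realType) (n : nat) (x : 'cV[R]_n) : R :=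
  \sum_(i < n) x i 0 ^+ 2.

Lemma sqnorm_ge0 (R : realType) (n : nat) (x : 'cV[R]_n) : 0 <= sqnorm x.
Proof. by apply: sumr_ge0 => i _; apply: sqr_ge0. Qed.

(** Cauchy-Schwarz row by row; the double sum is the squared Frobenius norm of [B]. *)
Lemma sqnorm_mulmx_le (R : realType) (m n : nat) (B : 'M[R]_(m, n))
    (x : 'cV[R]_n) :
  sqnorm (B *m x) <= (\sum_i \sum_j B i j ^+ 2) * sqnorm x.
Proof.
by rewrite mulr_suml; apply: ler_sum => i _; rewrite mxE; apply: sum_mul_sqr_le.
Qed.

Lemma sqnorm_mulmx_sym (R : realType) (n : nat) (M : 'M[R]_n) (x : 'cV[R]_n) :
  M^T = M -> sqnorm (M *m x) ^+ 2 <= sqnorm x * sqnorm (M *m (M *m x)).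
Proof.
move=> Msym.
have -> : sqnorm (M *m x) = \sum_i x i 0 * (M *m (M *m x)) i 0.
  transitivity (((M *m x)^T *m (M *m x)) 0 0).
    by rewrite mxE; apply: eq_bigr => i _; rewrite [_^T _ _]mxE -expr2.
  rewrite trmx_mul Msym -mulmxA mxE; apply: eq_bigr => i _.
  by rewrite [x^T _ _]mxE.
exact: sum_mul_sqr_le.
Qed.

Lemma trmxX (R : realType) (n m : nat) (M : 'M[R]_n) :
  (M ^+ m)^T = M^T ^+ m.
Proof.
elim: m => [|m IH]; first by rewrite !expr0 trmx1.
by rewrite exprS exprSr -IH [M * _]/(M *m _) trmx_mul.
Qed.

(** Applying [sqnorm_mulmx_sym] to the symmetric matrix [M ^+ (2 ^ j)] doubles the exponent. This
    replaces the spectral theorem and is why the moment order is dyadic. *)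
Lemma sqnorm_mulmx_iter (R : realType) (n : nat) (M : 'M[R]_n) (x : 'cV[R]_n)
    (j : nat) :
  M^T = M -> sqnorm x <= 1 ->
  sqnorm (M *m x) ^+ (2 ^ j) <= sqnorm (M ^+ (2 ^ j) *m x).
Proof.
move=> Msym x1; elim: j => [|j IH]; first by rewrite !expn0 !expr1.
rewrite expnS mulnC !exprM.
apply: (@le_trans _ _ (sqnorm (M ^+ (2 ^ j) *m x) ^+ 2)).
  by apply: lerXn2r => //; rewrite nnegrE ?exprn_ge0 ?sqnorm_ge0.
apply: (le_trans (sqnorm_mulmx_sym _ _)); first by rewrite trmxX Msym.
by rewrite mulmxA expr2 ler_piMl ?sqnorm_ge0.
Qed.

Lemma mxtrace_sym_sqr (R : realType) (n : nat) (B : 'M[R]_n) :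
  B^T = B -> \tr (B ^+ 2) = \sum_i \sum_j B i j ^+ 2.
Proof.
move=> Bsym; apply: eq_bigr => i _; rewrite expr2 [B * B]/(B *m B) mxE.
by apply: eq_bigr => j _; rewrite -{2}Bsym mxE expr2.
Qed.

(* Replaces Jensen's inequality in passing from E ||X||^N to E ||X||. *)
Lemma le_tangent_power (R : realType) (x lam : R) (m : nat) :
  0 <= x -> 0 < lam -> x <= lam + lam * (x ^+ m.+1 / lam ^+ m.+1).
Proof.
move=> x0 l0; rewrite -expr_div_n; have [xl|lx] := leP x lam.
  by rewrite ler_wpDr // mulr_ge0 ?exprn_ge0 ?divr_ge0 // ltW.
have h : x / lam <= (x / lam) ^+ m.+1.
  by rewrite ler_eXnr // ler_pdivlMr // mul1r ltW.
rewrite -{1}[x](divfK (lt0r_neq0 l0)) mulrC ler_wpDl ?(ltW l0) //.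
by rewrite ler_pM2l.
Qed.

Lemma opnorm_ge0 (R : realType) (n : nat) (M : 'M[R]_n) : 0 <= opnorm M.
Proof.
have [] := pselect (has_sup [set l2norm (M *m x) | x in
    [set x : 'cV[R]_n | l2norm x <= 1]]); last first.
  (* Where [has_sup] fails, [sup] takes its default value [0]. *)
  by move=> h; rewrite /opnorm sup_out.
move=> [_ ub]; apply: (@le_trans _ _ (l2norm (M *m 0))); first exact: sqrtr_ge0.
apply: ub_le_sup => //; exists 0 => //=.
by rewrite /l2norm big1 ?sqrtr0 // => i _; rewrite mxE expr0n.
Qed.

(** The bound is affine in the trace, so means can be taken directly. It is proved for each vector
    of the unit ball, the trace arising as the squared Frobenius norm of [M ^+ (2 ^ j)]. *)
Lemma opnorm_le_trace (R : realType) (n : nat) (M : 'M[R]_n) (lam : R)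
    (j : nat) :
  M^T = M -> 0 < lam ->
  opnorm M <= lam + lam * (\tr (M ^+ (2 ^ j).*2) / lam ^+ (2 ^ j).*2).
Proof.
move=> Msym l0; apply: ge_sup.
  exists (l2norm (M *m 0)); exists 0 => //=.
  by rewrite /l2norm big1 ?sqrtr0 // => i _; rewrite mxE expr0n.
move=> _ [x /= x1 <-].
have sx1 : sqnorm x <= 1.
  have := lerXn2r 2 (_ : l2norm x \in Num.nneg) (_ : (1 : R) \in Num.nneg) x1.
  by rewrite !nnegrE sqrtr_ge0 ler01 expr1n sqr_sqrtr ?sqnorm_ge0 //; apply.
have N0 : (0 < (2 ^ j).*2)%N by rewrite double_gt0 expn_gt0.
apply: (le_trans (le_tangent_power (2 ^ j).*2.-1 _ l0)).
  exact: sqrtr_ge0.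
rewrite (prednK N0) lerD2l ler_pM2l // ler_pM2r ?invr_gt0 ?exprn_gt0 //.
rewrite -mul2n exprM sqr_sqrtr ?sqnorm_ge0 //.
apply: (le_trans (sqnorm_mulmx_iter _ Msym sx1)).
apply: (le_trans (sqnorm_mulmx_le _ _)).
rewrite [in leRHS]mulnC exprM mxtrace_sym_sqr; last by rewrite trmxX Msym.
rewrite ler_piMr //.
by apply: sumr_ge0 => i _; apply: sumr_ge0 => k _; apply: sqr_ge0.
Qed.

Lemma mean_opnorm_le (R : realType) (I : finType) (n : nat)
    (ed : 'I_n -> 'I_n -> I) (pr : I -> R) (d N : R) (j : nat) :
  (forall i, injective (ed i)) -> (forall i k, ed i k = ed k i) ->
  (forall x, 0 <= pr x <= 1) -> 0 <= d ->
  (forall i, \sum_k pr (ed i k) <= d) -> (n <= 4 ^ (2 ^ j))%N ->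
  N = (2 ^ j).*2%:R ->
  bern_mean pr (fun e => opnorm (centered_mx ed pr e)) <=
  8 * Num.sqrt (N * (N + d)).
Proof.
move=> ed_inj ed_sym pr01 d0 prd nK; set K := (2 ^ j)%N => NE.
have K0 : (0 < K)%N by rewrite expn_gt0.
have N0 : 0 < N by rewrite NE ltr0n double_gt0.
have Nd : 0 < N + d by rewrite ltr_wpDr.
have NNd : 0 < N * (N + d) by rewrite mulr_gt0.
(* With the factor [4], [lam ^+ K.*2] is [4 ^+ K] times the power in [mean_trace_le], and [4 ^+ K]
   absorbs the dimension [n]. *)
pose lam := 4 * Num.sqrt (N * (N + d)).
have l0 : 0 < lam by rewrite mulr_gt0 // sqrtr_gt0.
apply: (@le_trans _ _ (bern_mean pr (fun e =>
    lam + lam / lam ^+ K.*2 * \tr (centered_mx ed pr e ^+ K.*2)))).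
  apply: bern_mean_le => // e; rewrite mulrAC -mulrA.
  apply: opnorm_le_trace => //.
  by apply/matrixP => i k; rewrite !mxE ed_sym.
rewrite bern_meanDl bern_meanZ.
have -> : 8 * Num.sqrt (N * (N + d)) = lam + lam by rewrite /lam; ring.
rewrite lerD2l -mulrA ler_piMr ?(ltW l0) // ler_pdivrMl ?exprn_gt0 // mulr1.
apply: (le_trans (mean_trace_le ed_inj pr01 d0 prd K0)).
rewrite -NE -mul2n exprM /lam (exprMn 2) sqr_sqrtr ?(ltW NNd) //.
have -> : 4 ^+ 2 * (N * (N + d)) = 4 * (4 * N * (N + d)) by ring.
rewrite [leRHS]exprMn ler_wpM2r //.
  by rewrite exprn_ge0 // -mulrA mulr_ge0 // ltW.
by rewrite -natrX ler_nat.
Qed.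

(** * From the probability space to the finite product law *)

(** The integrand is split into indicators of the fibers of [X]; measurability is asked fiber by
    fiber, [J] being a bare finite type. *)
Lemma expectation_finite (disp : measure_display) (T : measurableType disp)
    (R : realType) (P : probability T R) (J : finType) (X : T -> J)
    (g mu : J -> R) :
  (forall x, measurable (X @^-1` [set x])) -> (forall x, 0 <= g x) ->
  (forall x, P (X @^-1` [set x]) = (mu x)%:E) ->
  ('E_P[fun w => g (X w)])%E = (\sum_x mu x * g x)%:E.
Proof.
move=> mX g0 PX; rewrite unlock.
transitivity (\int[P]_w \sum_x ((g x)%:E * (\1_(X @^-1` [set x]) w)%:E))%E.
  apply: eq_integral => w _; rewrite (bigD1 (X w)) //= big1 ?adde0; last first.
    move=> x xw; rewrite indicE memNset ?mule0 //= => /esym/eqP.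
    by rewrite (negPf xw).
  by rewrite indicE mem_set ?mule1.
rewrite ge0_integral_sum //.
- rewrite -sumEFin; apply: eq_bigr => x _.
  rewrite ge0_integralZl_EFin //; last first.
    by apply/measurable_EFinP; apply: measurable_indic.
  by rewrite integral_indic // setIT [X in (_ * X)%E](PX x) -EFinM mulrC.
- move=> x; apply: measurable_funeM.
  by apply/measurable_EFinP; apply: measurable_indic.
- by move=> x w _; rewrite mule_ge0 ?lee_fin.
Qed.

Definition undirected_edge (n : nat) (i j : 'I_n) : 'I_n * 'I_n :=
  if (i <= j)%N then (i, j) else (j, i).

Lemma undirected_edgeC (n : nat) (i j : 'I_n) :
  undirected_edge i j = undirected_edge j i.
Proof.
rewrite /undirected_edge; case: (ltngtP i j) => // ij.
by have -> : i = j by apply: val_inj.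
Qed.

Lemma undirected_edge_inj (n : nat) (i : 'I_n) : injective (undirected_edge i).
Proof.
by move=> j k; rewrite /undirected_edge; do 2 case: ifP => _; congruence.
Qed.

Lemma undirected_edge_le (n : nat) (i j : 'I_n) :
  ((undirected_edge i j).1 <= (undirected_edge i j).2)%N.
Proof. by rewrite /undirected_edge; case: (leqP i j) => // /ltnW. Qed.

(** Pairs below the diagonal get probability [0], matching the constant [false] in
    [edge_indicators], so that all of ['I_n * 'I_n] can index the product law. *)
Definition edge_prob (R : realType) (n : nat) (p q : R) (comm : 'I_n -> bool)
    (e : 'I_n * 'I_n) : R :=
  if (e.1 <= e.2)%N then (if comm e.1 == comm e.2 then p else q) else 0.

Lemma edge_prob_undirected (R : realType) (n : nat) (p q : R)
    (comm : 'I_n -> bool) (i j : 'I_n) :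
  edge_prob p q comm (undirected_edge i j) =
  if comm i == comm j then p else q.
Proof.
rewrite /edge_prob undirected_edge_le /undirected_edge.
by case: (i <= j)%N => /=; rewrite // (eq_sym (comm i)).
Qed.

Definition edge_indicators (disp : measure_display) (T : measurableType disp)
    (R : realType) (P : probability T R) (n : nat)
    (E : 'I_n -> 'I_n -> {RV P >-> bool}) (w : T) :
    {ffun 'I_n * 'I_n -> bool} :=
  [ffun e : 'I_n * 'I_n => (e.1 <= e.2)%N && E e.1 e.2 w].

(** A vertex sees [n./2] vertices of each community, itself included, so the loop convention makes
    the row sum exactly [d]. *)
Lemma sum_edge_prob (disp : measure_display) (T : measurableType disp)
    (R : realType) (P : probability T R) (n : nat) (p q : R)
    (comm : 'I_n -> bool) (E : 'I_n -> 'I_n -> {RV P >-> bool}) (i : 'I_n) :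
  ~~ odd n -> stochastic_block_model p q comm E ->
  \sum_j edge_prob p q comm (undirected_edge i j) = (p + q) * n%:R / 2.
Proof.
move=> evn sbm.
under eq_bigr do rewrite edge_prob_undirected.
rewrite (bigID (fun j => comm j == comm i)) /=.
rewrite (eq_bigr (fun=> p)); last by move=> j /eqP ->; rewrite eqxx.
rewrite [X in _ + X](eq_bigr (fun=> q)); last first.
  by move=> j; rewrite eq_sym => /negPf ->.
have nE : n%:R = 2 * (n./2)%:R :> R.
  by rewrite -natrM mul2n even_halfK //.
rewrite !sumr_const -(cardsE (fun j => comm j == comm i)) (sbm_balanced sbm).
rewrite (_ : #|_| = n./2); last first.
  rewrite -(sbm_balanced sbm (~~ comm i)) -cardsE; apply: eq_card => j.
  by rewrite !inE unfold_in; case: (comm j); case: (comm i).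
by rewrite nE -(mulr_natr p) -(mulr_natr q); field.
Qed.

Lemma sbm_edgeE (disp : measure_display) (T : measurableType disp)
    (R : realType) (P : probability T R) (n : nat) (p q : R)
    (comm : 'I_n -> bool) (E : 'I_n -> 'I_n -> {RV P >-> bool})
    (i j : 'I_n) (b : bool) :
  0 <= p <= 1 -> 0 <= q <= 1 -> stochastic_block_model p q comm E ->
  P (E i j @^-1` [set b]) = (bern (if comm i == comm j then p else q) b)%:E.
Proof.
move=> p01 q01 sbm; have := sbm_bernoulli sbm i j [set b].
rewrite bernoulli_probE; last by case: ifP.
rewrite /distribution /pushforward => ->.
rewrite !diracE; case: b => /=.
  rewrite mem_set // memNset //= mule0 mule1 adde0 //.
by rewrite memNset // mem_set //= mule0 mule1 add0e.
Qed.

Lemma edge_indicators_preimage (disp : measure_display)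
    (T : measurableType disp) (R : realType) (P : probability T R) (n : nat)
    (E : 'I_n -> 'I_n -> {RV P >-> bool}) (f : {ffun 'I_n * 'I_n -> bool}) :
  (forall e, f e -> (e.1 <= e.2)%N) ->
  edge_indicators E @^-1` [set f] =
  \bigcap_(e in [set` [set e : 'I_n * 'I_n | (e.1 <= e.2)%N]%SET])
    (E e.1 e.2 @^-1` [set f e]).
Proof.
move=> fD; apply/seteqP; split => w /=.
  by move=> <- e /=; rewrite inE => eD; rewrite ffunE eD.
move=> h; apply/ffunP => e; rewrite ffunE.
have [eD|eD] /= := boolP (e.1 <= e.2)%N.
  by have /= := h e; rewrite inE; apply.
by apply/esym/negbTE; apply: contra eD; apply: fD.
Qed.

Lemma edge_indicators_preimage0 (disp : measure_display)
    (T : measurableType disp) (R : realType) (P : probability T R) (n : nat)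
    (E : 'I_n -> 'I_n -> {RV P >-> bool}) (f : {ffun 'I_n * 'I_n -> bool})
    (e : 'I_n * 'I_n) :
  f e -> ~~ (e.1 <= e.2)%N -> edge_indicators E @^-1` [set f] = set0.
Proof.
move=> fe eD; apply/seteqP; split => w //= wf.
by move: fe; rewrite -wf ffunE (negPf eD).
Qed.

Lemma measurable_edge_indicators (disp : measure_display)
    (T : measurableType disp) (R : realType) (P : probability T R) (n : nat)
    (E : 'I_n -> 'I_n -> {RV P >-> bool}) (f : {ffun 'I_n * 'I_n -> bool}) :
  measurable (edge_indicators E @^-1` [set f]).
Proof.
have [/existsP[e /andP[fe eD]]|/existsPn fD] :=
    boolP [exists e, f e && ~~ (e.1 <= e.2)%N].
  by rewrite (edge_indicators_preimage0 _ fe eD).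
rewrite edge_indicators_preimage; last first.
  by move=> e fe; have := fD e; rewrite fe /= negbK.
apply: fin_bigcap_measurable => // e _.
by exact: measurable_funPTI.
Qed.

(** A configuration that is true below the diagonal is impossible, and both sides are zero; any
    other one factors by independence. *)
Lemma edge_indicatorsE (disp : measure_display) (T : measurableType disp)
    (R : realType) (P : probability T R) (n : nat) (p q : R)
    (comm : 'I_n -> bool) (E : 'I_n -> 'I_n -> {RV P >-> bool})
    (f : {ffun 'I_n * 'I_n -> bool}) :
  0 <= p <= 1 -> 0 <= q <= 1 -> stochastic_block_model p q comm E ->
  P (edge_indicators E @^-1` [set f]) =
  (\prod_e bern (edge_prob p q comm e) (f e))%:E.
Proof.
move=> p01 q01 sbm.
have [/existsP[e /andP[fe eD]]|/existsPn fD] :=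
    boolP [exists e, f e && ~~ (e.1 <= e.2)%N].
  rewrite (edge_indicators_preimage0 _ fe eD) measure0 (bigD1 e) //=.
  by rewrite /edge_prob (negPf eD) fe /= mul0r.
have {}fD e : f e -> (e.1 <= e.2)%N.
  by move=> fe; have := fD e; rewrite fe /= negbK.
rewrite edge_indicators_preimage //.
rewrite (@sbm_indep _ _ _ _ _ _ _ _ _ sbm _ (fun e => [set f e])) //.
rewrite (eq_bigr (fun e => (bern (edge_prob p q comm e) (f e))%:E)); last first.
  move=> e; rewrite inE => eD.
  by rewrite (sbm_edgeE _ _ _ p01 q01 sbm) /edge_prob eD.
(* The pairs below the diagonal contribute factors [bern 0 false = 1]. *)
rewrite prodEFin; congr _%:E; rewrite big_mkcond /=; apply: eq_bigr => e _.
rewrite inE; case: ifPn => // eD.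
rewrite /edge_prob (negPf eD) /bern subr0.
by case: ifPn => // /fD; rewrite (negPf eD).
Qed.

Lemma adjacency_centered (disp : measure_display) (T : measurableType disp)
    (R : realType) (P : probability T R) (n : nat) (p q : R)
    (comm : 'I_n -> bool) (E : 'I_n -> 'I_n -> {RV P >-> bool}) (w : T) :
  0 <= p <= 1 -> 0 <= q <= 1 -> stochastic_block_model p q comm E ->
  adjacency_matrix E w - expected_matrix P (adjacency_matrix E) =
  centered_mx (@undirected_edge n) (edge_prob p q comm) (edge_indicators E w).
Proof.
move=> p01 q01 sbm; apply/matrixP => i j; rewrite !mxE; congr (_%:R - _).
  rewrite ffunE undirected_edge_le /undirected_edge /=.
  by case: ifP => //= _; rewrite (sbm_sym sbm).
rewrite edge_prob_undirected.
rewrite (_ : (fun _ => _) = \1_(E i j @^-1` [set true])); last first.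
  apply/funext => v; rewrite mxE indicE; congr (_%:R).
  by case Ev: (E i j v); [rewrite mem_set | rewrite memNset //= Ev].
rewrite expectation_indic ?(sbm_edgeE _ _ _ p01 q01 sbm) //.
by exact: measurable_funPTI.
Qed.

(** * Choice of the moment order, and conclusion *)

(** The base-two logarithm of [n], rounded up to [L], is rounded up again to a power of two, which
    at most doubles it. *)
Lemma dyadic_moment_order (R : realType) (n : nat) : (2 <= n)%N ->
  exists j : nat, (n <= 4 ^ (2 ^ j))%N /\
    (2 ^ j).*2%:R <= 8 / ln 2 * ln n%:R :> R.
Proof.
move=> n2; pose L := up_log 2 n; pose j := up_log 2 L.
have L0 : (0 < L)%N by rewrite up_log_gt0.
have Lj : (L <= 2 ^ j)%N by apply: up_logP.
have jL : (2 ^ j <= L.*2)%N.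
  have [L1|L1] := leqP L 1; first by rewrite /j; have -> : L = 1%N by lia.
  have := up_log_gtn (isT : (1 < 2)%N) L1; rewrite -/j.
  have : (0 < j)%N by rewrite up_log_gt0.
  by case: j {Lj} => // k _; rewrite /= expnS; lia.
exists j; split.
  apply: (leq_trans (up_logP n (isT : (1 < 2)%N))).
  rewrite -[4%N]/(2 ^ 2)%N -expnM leq_exp2l //; lia.
have ln2 : 0 < ln 2 :> R by rewrite ln_gt0 // ltr1n.
have lnn : ln 2 <= ln n%:R :> R.
  by rewrite ler_ln ?posrE ?ltr0n ?ler_nat //; lia.
have lnL : (L.-1)%:R * ln 2 <= ln n%:R :> R.
  rewrite mulr_natl -lnXn // ler_ln ?posrE ?exprn_gt0 ?ltr0n //; last lia.
  by rewrite -natrX ler_nat ltnW // up_log_gtn.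
rewrite mulrAC ler_pdivlMr //.
apply: (@le_trans _ _ ((4 * L)%:R * ln 2)).
  by rewrite ler_pM2r // ler_nat; lia.
(* Both [(L.-1)%:R * ln 2] and [ln 2] are at most [ln n%:R], whence the constant [8 = 4 + 4]. *)
have -> : (4 * L)%:R = 4 * (L.-1)%:R + 4 :> R.
  by rewrite -natrM -natrD; congr _%:R; lia.
by lra.
Qed.

Theorem theorem2p3p5 (R : realType) :
  exists C : R, 0 < C /\
    forall (n : nat) (p q : R) (disp : measure_display)
      (T : measurableType disp) (P : probability T R)
      (comm : 'I_n -> bool) (E : 'I_n -> 'I_n -> {RV P >-> bool}),
      (2 <= n)%N -> ~~ odd n ->
      0 <= q -> q < p -> p <= 1 ->
      stochastic_block_model p q comm E ->
      let A := adjacency_matrix E in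
      let d := (p + q) * n%:R / 2 in
      ('E_P[fun w => opnorm (A w - expected_matrix P A)]
        <= (C * (Num.sqrt (d * ln n%:R) + ln n%:R))%:E)%E.
Proof.
have ln2 : 0 < ln 2 :> R by rewrite ln_gt0 // ltr1n.
pose c : R := 8 / ln 2.
have c0 : 0 < c by rewrite divr_gt0.
(* The [8] is that of [mean_opnorm_le]; [1 + c] works because its square dominates both [c ^+ 2] and
   [c]. *)
exists (8 * (1 + c)); split; first by rewrite mulr_gt0 // addr_gt0.
move=> n p q disp T P comm E n2 evn q0 qp p1 sbm; cbv zeta.
set d := (p + q) * n%:R / 2.
have p01 : 0 <= p <= 1 by rewrite p1 (le_trans q0 (ltW qp)).
have q01 : 0 <= q <= 1 by rewrite q0 (le_trans (ltW qp) p1).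
have d0 : 0 <= d.
  by rewrite divr_ge0 // mulr_ge0 // addr_ge0 //; case/andP: p01.
under [fun w => _]funext do rewrite (adjacency_centered _ p01 q01 sbm).
rewrite (expectation_finite
  (g := fun e => opnorm (centered_mx (@undirected_edge n) (edge_prob p q comm) e))
  (measurable_edge_indicators E) (fun=> opnorm_ge0 _)
  (fun f => edge_indicatorsE f p01 q01 sbm)) lee_fin.
have [j [nj]] := dyadic_moment_order R n2; set N : R := _.*2%:R => Nln.
have pr01 e : 0 <= edge_prob p q comm e <= 1.
  by rewrite /edge_prob; case: ifP => _; [case: ifP | rewrite lexx ler01].
have prd i : \sum_k edge_prob p q comm (undirected_edge i k) <= d.
  by rewrite (sum_edge_prob i evn sbm).
apply: (le_trans (mean_opnorm_le (@undirected_edge_inj n)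
  (@undirected_edgeC n) pr01 d0 prd nj (erefl N))).
rewrite -mulrA ler_pM2l //.
have N0 : 0 <= N by rewrite ler0n.
set l := ln n%:R in Nln *.
have l0 : 0 <= l by rewrite ln_ge0 // ler1n; lia.
set s := Num.sqrt (d * l).
have s0 : 0 <= s := sqrtr_ge0 _.
have s2 : s ^+ 2 = d * l by rewrite sqr_sqrtr // mulr_ge0.
(* The right side is nonnegative, so it is written as the root of its square and the radicands are
   compared. *)
rewrite -[leRHS]ger0_norm ?mulr_ge0 ?addr_ge0 // ?(ltW c0) //.
rewrite -sqrtr_sqr ler_sqrt ?sqr_ge0 //.
apply: (@le_trans _ _ (c * l * (c * l + d))).
  by rewrite ler_pM ?addr_ge0 ?lerD2r.
rewrite -/c in Nln.
have -> : c * l * (c * l + d) = c ^+ 2 * l ^+ 2 + c * s ^+ 2 by rewrite s2; ring.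
have := mulr_ge0 s0 l0; have := sqr_ge0 s; have := sqr_ge0 l.
rewrite (exprMn 2 (1 + c)) (sqrrD s).
set a := l ^+ 2; set b := s ^+ 2; set t := s * l => a0 b0 t0.
have h : c ^+ 2 * a + c * b <= (1 + c) ^+ 2 * (a + b) by nra.
(* What separates [a + b] from the full square is the nonnegative cross term [t *+ 2]. *)
apply: (le_trans h); rewrite ler_wpM2l ?sqr_ge0 //.
by rewrite mulr2n; lra.
Qed.
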